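(* Let $g:\mathbb{R}^n\to(-\infty,\infty]$ be a proper, lower semicontinuous, convex function. Let $\{x^k\}$, $\{p^k\}$, $\{\varepsilon_k\}$ be sequences generated by the gradient-based inexact proximal point method (GIPPM, described in the context) with proximal parameter $\lambda>0$ and scaling factor $\mu>2$. Assume that $0\notin\partial g(x^k)$ for all $k\in\mathbb{N}$. Then either $\|x^k\|\to\infty$ as $k\to\infty$, or all of the following assertions hold: (i) Every accumulation point of $\{x^k\}$ is a minimizer of $g$, and both sequences $\{\|x^k-p^k\|\}$ and $\{\varepsilon_k\}$ converge to $0$ as $k\to\infty$. (ii) If the Moreau envelope $e_\lambda g$ satisfies the KL property at an accumulation point $\bar x$ of $\{x^k\}$, then $x^k\to\bar x$ as $k\to\infty$. (iii) If $e_\lambda g$ satisfies the KL property at an accumulation point $\bar x$ of $\{x^k\}$ with $\psi(t)=Mt^q$ for some $M>0$ and $q\in(0,1)$, then: - if $q\in(0,1/2]$, the sequence $\{x^k\}$ converges linearly to $\bar x$ as $k\to\infty$; - if $q\in(1/2,1)$, then $\|x^k-\bar x\|=\mathcal{O}\big(k^{-\frac{1-q}{2q-1}}\big)$ as $k\to\infty$.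
   Context: $\|\cdot\|$ is the Euclidean norm on $\mathbb{R}^n$ and $\mathbb{N}=\{1,2,\dots\}$. For a proper, lower semicontinuous, convex $g:\mathbb{R}^n\to(-\infty,\infty]$, the subdifferential at $x\in\mathrm{dom}\,g=\{x: g(x)<\infty\}$ is $\partial g(x)=\{v\in\mathbb{R}^n: \langle v,y-x\rangle\le g(y)-g(x)\text{ for all }y\in\mathbb{R}^n\}$, with $\partial g(x)=\emptyset$ for $x\notin\mathrm{dom}\,g$. For $\lambda>0$ the Moreau envelope and proximal mapping are $$e_\lambda g(x)=\inf_{y\in\mathbb{R}^n}\Big\{g(y)+\frac1{2\lambda}\|y-x\|^2\Big\},\qquad \mathrm{Prox}_{\lambda g}(x)=\mathop{\mathrm{argmin}}_{y\in\mathbb{R}^n}\Big\{g(y)+\frac1{2\lambda}\|y-x\|^2\Big\};$$ $e_\lambda g$ is $\mathcal{C}^1$-smooth and $\mathrm{Prox}_{\lambda g}$ is single-valued on $\mathbb{R}^n$. GIPPM algorithm. Step 0: choose a proximal parameter $\lambda>0$, an initial point $x^1\in\mathbb{R}^n$, an initial error $\varepsilon_1>0$, an error reduction factor $\theta\in(0,1)$ and a scaling factor $\mu>2$; set $k:=1$. Step 1: find $p^k\in\mathbb{R}^n$ and the smallest integer $i_k\in\{0,1,2,\dots\}$ such that $$\|p^k-\mathrm{Prox}_{\lambda g}(x^k)\|\le\lambda\theta^{i_k}\varepsilon_k\quad\text{and}\quad\|x^k-p^k\|>\lambda\mu\,\theta^{i_k}\varepsilon_k.$$ Step 2: set $x^{k+1}:=p^k$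 and $\varepsilon_{k+1}:=\theta^{i_k}\varepsilon_k$; increase $k$ by $1$ and go to Step 1. Step 1 is performed as follows: start with $i_k=0$ and choose some $p^k$ satisfying the first inequality; as long as the second inequality fails, increase $i_k$ by $1$ and choose again some $p^k$ satisfying the first inequality with the new $i_k$; ''smallest'' refers to the first value of $i_k$ at which this procedure stops. (The procedure stops after finitely many trials when $0\notin\partial g(x^k)$.) KL property: a differentiable function $f:\mathbb{R}^n\to\mathbb{R}$ satisfies the KL (Kurdyka-Łojasiewicz) property at $\bar x\in\mathbb{R}^n$ if there exist a number $\eta>0$, a neighborhood $U$ of $\bar x$, and a nondecreasing function $\psi:(0,\eta)\to(0,\infty)$ such that $1/\psi$ is integrable over $(0,\eta)$ and $$\|\nabla f(x)\|\ge\psi\big(f(x)-f(\bar x)\big)\quad\text{for all }x\in U\text{ with }f(\bar x)<f(x)<f(\bar x)+\eta.$$ ''KL property at $\bar x$ with $\psi(t)=Mt^q$'' means that this holds with that particular function $\psi$ (for some $\eta>0$ and some neighborhood $U$). A sequence $\{z^k\}$ converges linearly to $\bar z$ if there are $c>0$ and $t\in(0,1)$ with $\|z^k-\bar z\|\le c\,t^k$ for all sufficiently large $k$. *)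

(* Defs.v *)
From HB Require Import structures.
From mathcomp Require Import all_boot all_order all_algebra.
From mathcomp Require Import all_classical all_reals all_analysis.
Import Order.TTheory GRing.Theory Num.Theory.
Import numFieldNormedType.Exports.

Set Implicit Arguments.
Unset Strict Implicit.
Unset Printing Implicit Defensive.

Local Open Scope classical_set_scope.
Local Open Scope ring_scope.

(* The library norm `|u| on 'rV[R]_n is the sup norm, hence the Euclidean one
   below.  Both induce the same topology, so convergence, cluster points,
   neighborhoods and lower semicontinuity are the library's. *)
Definition dotr {R : realType} {n : nat} (u v : 'rV[R]_n) : R :=
  \sum_(i < n) u 0 i * v 0 i.

Definition enorm {R : realType} {n : nat} (u : 'rV[R]_n) : R :=
  Num.sqrt (dotr u u).

Definition proper_fun {T : Type} {R : realType} (g : T -> \bar R) : Prop :=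
  (forall x, (-oo < g x)%E) /\ (exists x, (g x < +oo)%E).

Definition convex_efun {R : realType} {n : nat} (g : 'rV[R]_n -> \bar R) : Prop :=
  forall (x y : 'rV[R]_n) (t : R), 0 < t < 1 ->
    (g (t *: x + (1 - t) *: y)%R <= t%:E * g x + (1 - t)%:E * g y)%E.

Definition subdiff {R : realType} {n : nat} (g : 'rV[R]_n -> \bar R)
    (x : 'rV[R]_n) : set 'rV[R]_n :=
  [set v | (g x < +oo)%E /\ forall y, ((dotr v (y - x))%:E <= g y - g x)%E].

Definition prox_obj {R : realType} {n : nat} (g : 'rV[R]_n -> \bar R)
    (lambda : R) (x y : 'rV[R]_n) : \bar R :=
  (g y + ((2 * lambda)^-1 * enorm (y - x) ^+ 2)%:E)%E.

Definition moreau {R : realType} {n : nat} (g : 'rV[R]_n -> \bar R)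
    (lambda : R) (x : 'rV[R]_n) : \bar R :=
  ereal_inf (range (prox_obj g lambda x)).

Definition argmin {T : Type} {R : realType} (F : T -> \bar R) : set T :=
  [set p | forall y, (F p <= F y)%E].

(* The point of the argmin set, which is a singleton when g is proper, lower
   semicontinuous and convex and 0 < lambda. *)
Definition prox {R : realType} {n : nat} (g : 'rV[R]_n -> \bar R)
    (lambda : R) (x : 'rV[R]_n) : 'rV[R]_n :=
  xget 0 (argmin (prox_obj g lambda x)).

(* Step 1 at the current point x with current error eps: trial j is the point
   chosen at the j-th trial, the trials 0, ..., i - 1 fail the second
   inequality, and trial i passes it and is returned as p. *)
Definition gippm_step1 {R : realType} {n : nat} (g : 'rV[R]_n -> \bar R)
    (lambda mu theta eps : R) (x p : 'rV[R]_n) (i : nat) : Prop :=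
  exists trial : nat -> 'rV[R]_n,
    [/\ forall j, (j <= i)%N ->
          enorm (trial j - prox g lambda x) <= lambda * theta ^+ j * eps,
        forall j, (j < i)%N ->
          enorm (x - trial j) <= lambda * mu * theta ^+ j * eps,
        enorm (x - trial i) > lambda * mu * theta ^+ i * eps
      & p = trial i].

(* The sequences are indexed from 1; their values at 0 are irrelevant. *)
Definition gippm {R : realType} {n : nat} (g : 'rV[R]_n -> \bar R)
    (lambda mu theta : R) (x p : nat -> 'rV[R]_n) (eps : nat -> R) : Prop :=
  forall k, (0 < k)%N -> exists i : nat,
    [/\ gippm_step1 g lambda mu theta (eps k) (x k) (p k) i,
        x k.+1 = p k
      & eps k.+1 = theta ^+ i * eps k].

Definition grad {R : realType} {n : nat} (f : 'rV[R]_n -> R) (x : 'rV[R]_n) :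
    'rV[R]_n :=
  \row_i ('D_(delta_mx 0 i) (f : 'rV[R]_n -> R^o) x : R).

(* Meant for differentiable f.  The values of psi outside ]0, eta[ are
   irrelevant. *)
Definition KL_with {R : realType} {n : nat} (f : 'rV[R]_n -> R)
    (xbar : 'rV[R]_n) (psi : R -> R) : Prop :=
  exists (eta : R) (U : set 'rV[R]_n),
    [/\ 0 < eta /\ nbhs xbar U,
        forall t, 0 < t < eta -> 0 < psi t,
        forall s t, 0 < s -> s <= t -> t < eta -> psi s <= psi t,
        (@lebesgue_measure R).-integrable `]0, eta[ (fun t => ((psi t)^-1)%:E)
      & forall x, U x -> f xbar < f x < f xbar + eta ->
          enorm (grad f x) >= psi (f x - f xbar)].

Definition KL {R : realType} {n : nat} (f : 'rV[R]_n -> R)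
    (xbar : 'rV[R]_n) : Prop :=
  exists psi : R -> R, KL_with f xbar psi.

Definition cvg_linearly {R : realType} {n : nat} (z : nat -> 'rV[R]_n)
    (zbar : 'rV[R]_n) : Prop :=
  exists c t : R, [/\ 0 < c, 0 < t < 1
    & \forall k \near \oo, enorm (z k - zbar) <= c * t ^+ k].

(* Main.v *)
Require Import Defs.
From HB Require Import structures.
From mathcomp Require Import all_boot all_order all_algebra.
From mathcomp Require Import all_classical all_reals all_analysis.
From mathcomp Require Import finmap ring lra.
Import Order.TTheory GRing.Theory Num.Theory.
Import numFieldNormedType.Exports.
Set Implicit Arguments.
Unset Strict Implicit.
Unset Printing Implicit Defensive.
Local Open Scope classical_set_scope.
Local Open Scope ring_scope.

(** The envelope f = e_lambda g is convex with 1/lambda-Lipschitz gradient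
    d(x) = (x - Prox x) / lambda, so GIPPM is an inexact gradient descent on f.
    Writing s_k = |x^{k+1} - x^k|, the two tests of Step 1 bound the error of p^k
    by s_k / mu, whence f(x^{k+1}) + a s_k^2 <= f(x^k) and |grad f(x^k)| <= b s_k
    with a, b > 0 (the former needs mu > 2).  If |x^k| does not tend to infinity
    there is a cluster point, so f(x^k) is bounded below, s_k -> 0, and every
    cluster point is a zero of grad f, i.e. a minimizer of g.  Under KL, with
    Phi a primitive of 1/psi, the step s_k is at most (b/a) times the decrease of
    Phi(f(x^k) - f(xbar)) as long as x^k is near xbar; telescoping traps the
    sequence near xbar and bounds |x^k - xbar| by (b/a) Phi(f(x^k) - f(xbar)).
    The rates follow from the recursion D_{k+1} + a' D_k^{2q} <= D_k for
    D_k = f(x^k) - f(xbar). *)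

(** * Euclidean inner product and norm, and their agreement with the library topology *)

Section EuclideanNorm.
Context {R : realType} {n : nat}.
Implicit Types u v w : 'rV[R]_n.

Lemma dotrC u v : dotr u v = dotr v u.
Proof. by apply: eq_bigr => i _; rewrite mulrC. Qed.

Lemma dotrDl u v w : dotr (u + v) w = dotr u w + dotr v w.
Proof. by rewrite /dotr -big_split; apply: eq_bigr => i _; rewrite !mxE mulrDl. Qed.

Lemma dotrZl (a : R) u v : dotr (a *: u) v = a * dotr u v.
Proof. by rewrite /dotr mulr_sumr; apply: eq_bigr => i _; rewrite !mxE mulrA. Qed.

Lemma dotrNl u v : dotr (- u) v = - dotr u v.
Proof. by rewrite -scaleN1r dotrZl mulN1r. Qed.

Lemma dotrDr u v w : dotr u (v + w) = dotr u v + dotr u w.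
Proof. by rewrite dotrC dotrDl !(dotrC _ u). Qed.

Lemma dotrZr (a : R) u v : dotr u (a *: v) = a * dotr u v.
Proof. by rewrite dotrC dotrZl dotrC. Qed.

Lemma dotrNr u v : dotr u (- v) = - dotr u v.
Proof. by rewrite dotrC dotrNl dotrC. Qed.

Lemma dotr_delta u i : dotr u (delta_mx 0 i) = u 0 i.
Proof.
rewrite /dotr (bigD1 i) //= big1 ?addr0 => [|j /negPf ji].
  by rewrite mxE !eqxx mulr1.
by rewrite mxE eqxx ji mulr0.
Qed.

Lemma dotr_ge0 u : 0 <= dotr u u.
Proof. by apply: sumr_ge0 => i _; rewrite -expr2 sqr_ge0. Qed.

Lemma enorm_ge0 u : 0 <= enorm u.
Proof. exact: sqrtr_ge0. Qed.

Lemma enorm_sqr u : enorm u ^+ 2 = dotr u u.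
Proof. by rewrite sqr_sqrtr ?dotr_ge0. Qed.

Lemma enormZ (a : R) u : enorm (a *: u) = `|a| * enorm u.
Proof.
by rewrite /enorm dotrZl dotrZr mulrA -expr2 sqrtrM ?sqr_ge0// sqrtr_sqr.
Qed.

Lemma enormN u : enorm (- u) = enorm u.
Proof. by rewrite -scaleN1r enormZ normrN1 mul1r. Qed.

Lemma enorm_distC u v : enorm (u - v) = enorm (v - u).
Proof. by rewrite -enormN opprB. Qed.

Lemma normr_le_enorm u : `|u| <= enorm u.
Proof.
have [-> //|u0] := eqVneq `|u| 0; first exact: enorm_ge0.
have [[i j] /= uij] := mx_norm_neq0 u0.
rewrite (uij : `|u| = _) (ord1 i) -sqrtr_sqr ler_sqrt ?dotr_ge0//.
rewrite /dotr (bigD1 j)//= -expr2 lerDl.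
by apply: sumr_ge0 => k _; rewrite -expr2 sqr_ge0.
Qed.

Lemma coord_le_normr u i : `|u 0 i| <= `|u|.
Proof. by rewrite [leRHS]mx_normrE; apply: (@le_bigmax _ _ _ 0 _ (0, i)). Qed.

Lemma enorm_le_normr u : enorm u <= Num.sqrt n%:R * `|u|.
Proof.
rewrite -(ger0_norm (normr_ge0 u))// -sqrtr_sqr -sqrtrM// ler_sqrt; last first.
  by rewrite mulr_ge0// sqr_ge0.
apply: (@le_trans _ _ (\sum_(i < n) `|u| ^+ 2)).
  apply: ler_sum => i _; rewrite -expr2 -(real_normK (num_real (u 0 i))).
  by rewrite ler_pXn2r ?nnegrE// coord_le_normr.
by rewrite sumr_const card_ord mulr_natl.
Qed.

Lemma enorm_eq0 u : enorm u = 0 -> u = 0.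
Proof. by move=> u0; apply/normr0_eq0/le_anti; rewrite -{1}u0 normr_le_enorm/=. Qed.

Lemma enorm_sqrD u v : enorm (u + v) ^+ 2 = enorm u ^+ 2 + 2 * dotr u v + enorm v ^+ 2.
Proof. by rewrite !enorm_sqr dotrDl !dotrDr (dotrC v u); ring. Qed.

(** Cauchy-Schwarz: expand the square of [enorm v *: u - enorm u *: v] and cancel
    [enorm u * enorm v]; zero vectors are set apart because this factor vanishes for them. *)
Lemma dotr_le_enorm u v : dotr u v <= enorm u * enorm v.
Proof.
have [/enorm_eq0->|u0] := eqVneq (enorm u) 0.
  by rewrite -(scale0r 0) dotrZl enormZ normr0 !mul0r.
have [/enorm_eq0->|v0] := eqVneq (enorm v) 0.
  by rewrite -(scale0r 0) dotrZr enormZ normr0 !mul0r mulr0.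
have ugt0 : 0 < enorm u by rewrite lt_def u0 enorm_ge0.
have vgt0 : 0 < enorm v by rewrite lt_def v0 enorm_ge0.
have := dotr_ge0 (enorm v *: u - enorm u *: v).
rewrite !(dotrDl, dotrDr, dotrNl, dotrNr, dotrZl, dotrZr) -!enorm_sqr (dotrC v u).
move=> h; rewrite -(ler_pM2l (mulr_gt0 ugt0 vgt0)) -subr_ge0.
rewrite -(pmulr_rge0 _ (ltr0Sn R 1)); apply: le_trans h _.
by rewrite le_eqVlt; apply/orP; left; apply/eqP; ring.
Qed.

Lemma ler_enormD u v : enorm (u + v) <= enorm u + enorm v.
Proof.
rewrite -(@ler_pXn2r _ 2) ?nnegrE ?addr_ge0 ?enorm_ge0//.
rewrite enorm_sqr dotrDl !dotrDr (dotrC v u) -!enorm_sqr.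
by have := dotr_le_enorm u v; nra.
Qed.

Lemma ler_enorm_distD w u v : enorm (u - v) <= enorm (u - w) + enorm (w - v).
Proof. by apply: le_trans (ler_enormD _ _); rewrite addrA subrK. Qed.

Lemma nbhs_enorm_ball u (e : R) : 0 < e -> nbhs u [set v | enorm (v - u) < e].
Proof.
move=> e0; have c0 : 0 < Num.sqrt n%:R + 1 :> R by rewrite ltr_wpDl// sqrtr_ge0.
(* The [+ 1] keeps the divisor positive in dimension 0. *)
apply/nbhs_ballP; exists (e / (Num.sqrt n%:R + 1)); first exact: divr_gt0.
move=> v; rewrite mx_norm_ball /ball_/= distrC => vu.
apply: le_lt_trans (enorm_le_normr _) _.
rewrite ltr_pdivlMr// in vu; have := normr_ge0 (v - u); lra.
Qed.

Lemma nbhs_enormP u (U : set 'rV[R]_n) : nbhs u U ->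
  exists2 e : R, 0 < e & forall v, enorm (v - u) < e -> U v.
Proof.
move=> /nbhs_ballP[e /= e0 eU]; exists e => // v vu; apply: eU.
rewrite mx_norm_ball /ball_/= distrC.
exact: le_lt_trans (normr_le_enorm _) vu.
Qed.

Lemma continuous_enorm_dist u : continuous (fun v => enorm (v - u)).
Proof.
move=> w U /nbhs_ballP[e /= e0 eU].
apply: filterS (nbhs_enorm_ball w e0) => v /= vw; apply: eU; rewrite /ball/=.
rewrite ltr_norml; have := ler_enorm_distD w v u; have := ler_enorm_distD v w u.
by rewrite (enorm_distC w v); lra.
Qed.

Lemma compact_enorm_ball u (r : R) : compact [set v | enorm (v - u) <= r].
Proof.
apply: bounded_closed_compact.
  exists (`|u| + r); split; first exact: num_real.
  move=> M Mr v /= vu; have := normr_le_enorm (v - u).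
  by have := lerB_dist v u; lra.
have -> : [set v | enorm (v - u) <= r] =
  (fun v => enorm (v - u)) @^-1` [set s | s <= r] by [].
apply: closed_comp; last exact: closed_le.
by move=> v _; exact: continuous_enorm_dist.
Qed.

End EuclideanNorm.

(** * Minima of lower semicontinuous functions on compact sets *)

Lemma lower_semicontinuous_compact_min {R : realType} {T : ptopologicalType}
    (F : T -> \bar R) (A : set T) (x0 : T) :
  lower_semicontinuous F -> compact A -> A x0 ->
  exists2 p, A p & forall y, A y -> (F p <= F y)%E.
Proof.
(* Without a minimizer the open sets {F > F y}, y in A, cover A; the least F y of
   a finite subcover is then attained at an uncovered point. *)
move=> Flsc cA Ax0; apply: contrapT => nomin.
have Abelow p : A p -> exists2 y, A y & (F y < F p)%E.
  move=> Ap; apply: contrapT => noy; apply: nomin; exists p => // y Ay.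
  by rewrite leNgt; apply/negP => yp; apply: noy; exists y.
have oF (c : \bar R) : open [set z | (c < F z)%E].
  case: c => [r| |].
  - exact: (lower_semicontinuousP F).1.
  - rewrite (_ : [set z | _] = set0) ?predeqE; first exact: open0.
    by move=> z; split=> //=; rewrite ltNge leey.
  - rewrite openE => z /= Fz.
    have [a aFz] : exists a : R, (a%:E < F z)%E.
      case: (F z) Fz => // [r _|_]; last by exists 0; rewrite ltey.
      by exists (r - 1); rewrite lte_fin ltrBlDr ltrDl.
    have [V Vz VF] := Flsc z a aFz; apply: filterS Vz => y /VF.
    by apply: lt_trans; rewrite ltNyr.
move: cA; rewrite compact_cover => /(_ _ A (fun y => [set z | (F y < F z)%E])).
case=> [y _|p /Abelow[y]|D DA AD]; [exact: oF|by exists y|].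
have seq_min (s : seq T) : s != [::] ->
    exists2 z, z \in s & forall y, y \in s -> (F z <= F y)%E.
  elim: s => // a [_ _|b s /(_ isT)[z zs zmin] _].
    by exists a; rewrite ?mem_seq1// => y; rewrite mem_seq1 => /eqP->.
  have [az|/ltW za] := leP (F a) (F z).
    exists a; rewrite ?mem_head// => y; rewrite in_cons => /predU1P[->//|/zmin].
    exact: le_trans.
  exists z; first by rewrite in_cons zs orbT.
  by move=> y; rewrite in_cons => /predU1P[->//|/zmin].
have [z zD zmin] : exists2 z, z \in (D : seq T) &
    forall y, y \in (D : seq T) -> (F z <= F y)%E.
  apply: seq_min; apply/eqP => D0; have [i /= iD _] := AD _ Ax0.
  by have : i \in (D : seq T) := iD; rewrite D0.
have [i /= iD Fiz] := AD z (set_mem (DA _ zD)).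
by move: Fiz; rewrite ltNge (zmin i iD).
Qed.

(** * Existence of the proximal point *)

Section ProximalMapping.
Context {R : realType} {n : nat} (g : 'rV[R]_n -> \bar R) (lambda : R).
Hypotheses (g_proper : proper_fun g) (g_lsc : lower_semicontinuous g).
Hypotheses (g_convex : convex_efun g) (lambda_gt0 : 0 < lambda).
Implicit Types x y z : 'rV[R]_n.

Lemma prox_obj_lsc x : lower_semicontinuous (prox_obj g lambda x).
Proof.
move=> y a; rewrite /prox_obj => ay.
pose q z := (2 * lambda)^-1 * enorm (z - x) ^+ 2.
(* The threshold is split as [a = b + (a - b)]: [g] stays above [b] by semicontinuity and [q] above
   [a - b] by continuity. *)
have [b by_ aby] : exists2 b : R, (b%:E < g y)%E & a < b + q y.
  move: ay; have := g_proper.1 y; case: (g y) => // [r _|_ _].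
    rewrite -EFinD lte_fin => ar; exists (r - (r + q y - a) / 2).
      by rewrite lte_fin; rewrite /q; lra.
    by rewrite /q; lra.
  by exists (a - q y + 1); rewrite ?ltey//; lra.
have [V Vy Vg] := g_lsc by_.
have cq : continuous q.
  move=> z; apply: (@continuous_comp _ _ _ (fun z => enorm (z - x))
    (fun s => (2 * lambda)^-1 * s ^+ 2)).
    exact: continuous_enorm_dist.
  by apply: cvgM; [exact: cvg_cst|exact: exprn_continuous].
have Wy : nbhs y (q @^-1` [set s | a - b < s]).
  by apply: cq; apply: open_nbhs_nbhs; split; [exact: open_gt|rewrite /=; lra].
exists (V `&` (q @^-1` [set s | a - b < s])); first exact: filterI.
move=> z [/Vg bz /= abz]; rewrite -/(q z).
apply: (@lt_le_trans _ _ (b + q z)%:E); first by rewrite lte_fin; lra.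
by rewrite EFinD leeD2r// ltW.
Qed.

(** Coercivity: outside a large ball around a point [x0] of the domain the objective is at least its
    value at [x0], so a minimizer over the compact ball is a global one. *)
Lemma prox_exists x : argmin (prox_obj g lambda x) !=set0.
Proof.
have [x0] := g_proper.2; have := g_proper.1 x0.
case gx0 : (g x0) => [G0| |]// _ _.
have x00 : enorm (x0 - x0) = 0.
  by rewrite subrr -(scale0r 0) enormZ normr0 mul0r.
have [w wball wmin] := lower_semicontinuous_compact_min g_lsc
  (@compact_enorm_ball _ _ x0 1) (x0 := x0) ltac:(by rewrite /= x00).
have [m gw] : exists m, g w = m%:E.
  have := wmin x0; rewrite /= x00 => /(_ ler01); rewrite gx0.
  by have := g_proper.1 w; case: (g w) => // r; exists r.
have mG0 : m <= G0 by rewrite -lee_fin -gw -gx0 wmin//= x00.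
pose c := (2 * lambda)^-1.
have c0 : 0 < c by rewrite invr_gt0 mulr_gt0.
pose a := enorm (x0 - x).
have a0 : 0 <= a := enorm_ge0 _.
(* For [r > rho] this gives [r > 1], [r >= a] and [c * (r - 2 * a) >= G0 - m]; then (r - a)^2 c -
   a^2 c = r c (r - 2a) pays for the possible drop r (G0 - m) of [g]. *)
pose rho := 1 + (G0 - m) / c + 2 * a.
have X0 : 0 <= (G0 - m) / c by rewrite divr_ge0 ?subr_ge0// ltW.
have rho1 : 1 <= rho by rewrite /rho; lra.
have [p pball pmin] := lower_semicontinuous_compact_min (prox_obj_lsc (x := x))
  (@compact_enorm_ball _ _ x0 rho) (x0 := x0) ltac:(by rewrite /= x00; lra).
exists p => y; have [/pmin//|ry] := leP (enorm (y - x0)) rho.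
apply: (@le_trans _ _ (prox_obj g lambda x x0)).
  by apply: pmin; rewrite /= x00; lra.
(* Outside the ball of radius rho, convexity along [x0, y] and the lower bound m of
   g on the unit ball give g y >= r m - (r - 1) G0, which the quadratic term beats. *)
rewrite /prox_obj gx0 -/c; have := g_proper.1 y.
case gy : (g y) => [b| |]// _; last by rewrite addye ?leey.
rewrite -2!EFinD lee_fin.
set r := enorm (y - x0) in ry.
have r1 : 1 < r by lra.
have r0 : r != 0 by rewrite gt_eqF//; apply: lt_trans r1.
have t01 : 0 < r^-1 < 1 by rewrite invr_gt0 invf_lt1 //; lra.
have := g_convex y x0 t01.
rewrite gy gx0 -!EFinM -EFinD.
have zball : enorm (r^-1 *: y + (1 - r^-1) *: x0 - x0) <= 1.
  rewrite scalerBl scale1r addrA addrAC addrK -scalerBr enormZ.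
  by rewrite gtr0_norm ?mulVf//; lra.
move=> /(le_trans (wmin _ zball)); rewrite gw lee_fin => hm.
have hb : r * m <= b + (r - 1) * G0.
  have -> : b + (r - 1) * G0 = r * (r^-1 * b + (1 - r^-1) * G0) by field.
  by rewrite ler_pM2l//; lra.
have yx : r - a <= enorm (y - x).
  have := ler_enorm_distD x y x0; rewrite -/r (enorm_distC x) -/a; lra.
have ra : 0 <= r - a by move: ry; rewrite /rho; lra.
have h2 : (r - a) ^+ 2 <= enorm (y - x) ^+ 2 by rewrite ler_pXn2r// nnegrE enorm_ge0.
have h3 : G0 - m <= c * (r - 2 * a).
  rewrite mulrC -ler_pdivrMr//; move: ry; rewrite /rho; lra.
rewrite -/a; move: (ler_wpM2l (ltW c0) h2) => h4.
by nra.
Qed.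

End ProximalMapping.

(** * Convexity, smoothness and gradient of the Moreau envelope *)

Section MoreauEnvelope.
Context {R : realType} {n : nat} (g : 'rV[R]_n -> \bar R) (lambda : R).
Hypotheses (g_proper : proper_fun g) (g_lsc : lower_semicontinuous g).
Hypotheses (g_convex : convex_efun g) (lambda_gt0 : 0 < lambda).
Implicit Types x y z : 'rV[R]_n.

Let P := prox g lambda.
Let f := fine \o moreau g lambda.
Let d x : 'rV[R]_n := lambda^-1 *: (x - P x).

Lemma prox_argmin x : argmin (prox_obj g lambda x) (P x).
Proof.
by case: (prox_exists g_proper g_lsc g_convex lambda_gt0 x) => p hp; exact: xgetI hp.
Qed.

Lemma prox_fin x : g (P x) = (fine (g (P x)))%:E.
Proof.
have [x0 gx0] := g_proper.2.
have := prox_argmin x x0; rewrite /prox_obj.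
have := g_proper.1 (P x); have := g_proper.1 x0; move: gx0.
by case: (g x0) => // r _ _; case: (g (P x)).
Qed.

Lemma moreau_prox x : moreau g lambda x = prox_obj g lambda x (P x).
Proof.
apply/le_anti/andP; split; first by apply: ereal_inf_lbound; exists (P x).
by apply: le_ereal_inf_tmp => _ [y _ <-]; exact: prox_argmin.
Qed.

Lemma fine_moreau x :
  f x = fine (g (P x)) + (2 * lambda)^-1 * enorm (P x - x) ^+ 2.
Proof. by rewrite /f/= moreau_prox /prox_obj prox_fin. Qed.

Lemma fine_moreau_le x y :
  f y <= fine (g (P x)) + (2 * lambda)^-1 * enorm (P x - y) ^+ 2.
Proof.
rewrite fine_moreau; have := prox_argmin y (P x).
by rewrite /prox_obj (prox_fin x) (prox_fin y).
Qed.

(** Optimality condition of the proximal problem: on the segment from [P x] to [y] a violation would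
    be a gain of first order in t, against a quadratic cost of second order. *)
Lemma prox_subgradient x y :
  (g (P x) + (lambda^-1 * dotr (x - P x) (y - P x))%:E <= g y)%E.
Proof.
have := g_proper.1 y; case gy : (g y) => [b| |]// _; last exact: leey.
rewrite prox_fin -EFinD lee_fin leNgt; apply/negP => ltb.
(* Minimality at P x + t (y - P x) for a t so small that t K < e. *)
set A := fine _ in ltb; set D := dotr _ _ in ltb.
pose K := (2 * lambda)^-1 * dotr (y - P x) (y - P x).
have K0 : 0 <= K by rewrite mulr_ge0 ?dotr_ge0// invr_ge0 mulr_ge0// ltW.
pose e := A + lambda^-1 * D - b.
have e0 : 0 < e by rewrite /e; lra.
have s0 : 0 < e + 2 * K + 2 by lra.
pose t := e / (e + 2 * K + 2).
have t01 : 0 < t < 1 by rewrite divr_gt0//= ltr_pdivrMr//; lra.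
have := g_convex y (P x) t01; rewrite gy prox_fin -/A -!EFinM -EFinD => hz.
have := prox_argmin x (t *: y + (1 - t) *: P x); rewrite /prox_obj prox_fin -/A.
have -> : t *: y + (1 - t) *: P x - x = - (x - P x) + t *: (y - P x).
  by apply/rowP => i; rewrite !mxE; ring.
move=> /le_trans /(_ (leeD2r _ hz)); rewrite -!EFinD lee_fin.
rewrite (enorm_sqrD (- (x - P x))) opprB dotrZr -[P x - x]opprB dotrNl -/D.
rewrite enormZ exprMn real_normK ?num_real// (enorm_sqr (y - P x)) => h.
have t0 : t != 0 by rewrite gt_eqF//; case/andP: t01.
have tK : t * (e + 2 * K + 2) = e by rewrite /t divfK// gt_eqF.
suff : e <= t * K by case/andP: t01; nra.
rewrite -(ler_pM2l (x := t)); last by case/andP: t01.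
rewrite -subr_ge0 in h; rewrite -subr_ge0; apply: le_trans h _.
rewrite /e /K le_eqVlt; apply/orP; left; apply/eqP; field.
by rewrite gt_eqF.
Qed.

(** The subgradient inequality at [P x], tested at [P y], is the only estimate; the rest is an
    identity. The quadratic term, beyond convexity, is what later gives the Lipschitz gradient. *)
Lemma moreau_convex_lower x y :
  f x + dotr (d x) (y - x) + lambda / 2 * enorm (d y - d x) ^+ 2 <= f y.
Proof.
have := prox_subgradient x (P y).
rewrite (prox_fin x) (prox_fin y) -EFinD lee_fin => h; rewrite !fine_moreau.
apply: le_trans (lerD h (lexx _)); rewrite -subr_ge0.
rewrite /d -scalerBr enormZ exprMn real_normK ?num_real// dotrZl !enorm_sqr.
move: (P x) (P y) => u v.
rewrite !(dotrDl, dotrDr, dotrNl, dotrNr) !(dotrC y) !(dotrC x).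
rewrite (dotrC v u) le_eqVlt; apply/orP; left; apply/eqP; field.
by rewrite gt_eqF.
Qed.

(** [P x] is a competitor in the minimization that defines [f y]; expanding the squares gives
    exactly the right-hand side. *)
Lemma moreau_smooth_upper x y :
  f y <= f x + dotr (d x) (y - x) + (2 * lambda)^-1 * enorm (y - x) ^+ 2.
Proof.
apply: le_trans (fine_moreau_le x y) _; rewrite fine_moreau -subr_ge0.
rewrite /d dotrZl !enorm_sqr; move: (P x) => u.
rewrite !(dotrDl, dotrDr, dotrNl, dotrNr) !(dotrC y) !(dotrC x) (dotrC u).
rewrite le_eqVlt; apply/orP; left; apply/eqP; field.
by rewrite gt_eqF.
Qed.

Lemma moreau_linear_approx x y :
  `|f y - f x - dotr (d x) (y - x)| <= (2 * lambda)^-1 * enorm (y - x) ^+ 2.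
Proof.
rewrite ler_norml; have := moreau_smooth_upper x y; have := moreau_convex_lower x y.
have : 0 <= (2 * lambda)^-1 * enorm (y - x) ^+ 2.
  by rewrite mulr_ge0 ?sqr_ge0// invr_ge0 mulr_ge0// ltW.
have : 0 <= lambda / 2 * enorm (d y - d x) ^+ 2.
  by rewrite mulr_ge0 ?sqr_ge0// divr_ge0// ltW.
move: (f x) (f y) (dotr _ _) (lambda / 2 * _) ((2 * lambda)^-1 * _) => a b u v w.
lra.
Qed.

(** Adding the lower bounds for (x, y) and (y, x) makes [d] co-coercive; Cauchy-Schwarz then allows
    division by [enorm (d y - d x)]. *)
Lemma moreau_gradient_lipschitz x y : lambda * enorm (d y - d x) <= enorm (y - x).
Proof.
have h1 := moreau_convex_lower x y; have h2 := moreau_convex_lower y x.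
have h3 := dotr_le_enorm (d y - d x) (y - x).
rewrite dotrDl dotrNl in h3; rewrite -(opprB y x) dotrNr (enorm_distC (d x)) in h2.
have key (a b u v r s : R) : a + u + lambda / 2 * r ^+ 2 <= b ->
    b - v + lambda / 2 * r ^+ 2 <= a -> v - u <= r * s -> 0 <= s -> 0 <= r ->
    lambda * r <= s.
  move=> {}h1 {}h2 {}h3 s0; rewrite le_eqVlt => /predU1P[<-|r0]; first by rewrite mulr0.
  by rewrite -(ler_pM2l r0); lra.
exact: key h1 h2 h3 (enorm_ge0 _) (enorm_ge0 _).
Qed.

(** The quadratic error of the linear approximation leaves an error of at most |h| C in the
    difference quotient along a coordinate direction. *)
Lemma grad_moreau x : grad f x = d x.
Proof.
apply/rowP => i; rewrite mxE -dotr_delta /derive; set e := delta_mx 0 i.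
apply: cvg_lim => //; apply/(@cvgrPdist_lt _ R^o) => /= eps eps0.
set C := (2 * lambda)^-1 * enorm e ^+ 2.
have C0 : 0 <= C by rewrite mulr_ge0 ?sqr_ge0// invr_ge0 mulr_ge0// ltW.
exists (eps / (C + 1)) => /=; first by rewrite divr_gt0//; lra.
move=> h /=; rewrite distrC subr0 ltr_pdivlMr; last by lra.
move=> hlt h0; have := moreau_linear_approx x (h *: e + x).
rewrite addrK dotrZr enormZ exprMn real_normK ?num_real// => le1.
have hp : 0 < `|h| by rewrite normr_gt0.
rewrite distrC -(ltr_pM2l hp) -normrM.
rewrite [X in `|X|](_ : _ = f (h *: e + x) - f x - h * dotr (d x) e); last first.
  by rewrite /GRing.scale/= mulrBr mulrA divff// mul1r.
apply: le_lt_trans le1 _.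
rewrite -(real_normK (num_real h)).
have -> : (2 * lambda)^-1 * (`|h| ^+ 2 * enorm e ^+ 2) = `|h| * (`|h| * C).
  by rewrite /C; ring.
by rewrite ltr_pM2l//; lra.
Qed.

Lemma moreau_ball_bound x y : enorm (y - x) <= 1 ->
  `|f y - f x| <= (enorm (d x) + (2 * lambda)^-1) * enorm (y - x).
Proof.
move=> yx1; have h := moreau_linear_approx x y.
have c0 : 0 < (2 * lambda)^-1 by rewrite invr_gt0 mulr_gt0.
have D1 := dotr_le_enorm (d x) (y - x); have D2 := dotr_le_enorm (d x) (- (y - x)).
rewrite dotrNr enormN in D2; have e0 := enorm_ge0 (y - x).
have sq : (2 * lambda)^-1 * enorm (y - x) ^+ 2 <= (2 * lambda)^-1 * enorm (y - x).
  by rewrite ler_pM2l// expr2 ler_piMl.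
by move: h; rewrite !ler_norml => /andP[h1 h2]; apply/andP; split; lra.
Qed.

Lemma continuous_moreau : continuous f.
Proof.
move=> x U /nbhs_ballP[e /= e0 eU]; set C := enorm (d x) + (2 * lambda)^-1.
have C0 : 0 <= C by rewrite addr_ge0 ?enorm_ge0// invr_ge0 mulr_ge0// ltW.
have r0 : 0 < Num.min 1 (e / (C + 1)) by rewrite lt_min ltr01 divr_gt0//; lra.
apply: filterS (nbhs_enorm_ball x r0) => y /=; rewrite lt_min => /andP[y1 ye].
apply: eU; rewrite /ball/= distrC.
apply: le_lt_trans (moreau_ball_bound (ltW y1)) _; rewrite -/C.
by move: ye; rewrite ltr_pdivlMr; have := enorm_ge0 (y - x); nra.
Qed.

Lemma argmin_of_prox_fixed x : P x = x -> argmin g x.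
Proof.
move=> Px y; have := prox_subgradient x y.
by rewrite Px subrr -(scale0r 0) dotrZl mul0r mulr0 adde0.
Qed.

End MoreauEnvelope.

(** * Cluster points, and sequences trapped near them by a telescoping bound *)

Section TrappedSequences.
Context {R : realType} {n : nat}.
Implicit Types (x : nat -> 'rV[R]_n) (xbar : 'rV[R]_n).

Lemma cluster_frequently x xbar (K : nat) (e : R) :
  cluster (x @ \oo) xbar -> 0 < e ->
  exists2 k, (K <= k)%N & enorm (x k - xbar) < e.
Proof.
move=> xc e0; have xK : (x @ \oo) (x @` [set k | (K <= k)%N]).
  by exists K => // k Kk; exists k.
by have [_ [[k Kk <-] ke]] := xc _ _ xK (nbhs_enorm_ball xbar e0); exists k.
Qed.

(** Some ball is visited at arbitrarily late indices; restricting the filter [\oo] to these visits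
    keeps it proper, and compactness of the ball applies. *)
Lemma cluster_of_not_cvgry x :
  ~ (enorm (x k) @[k --> \oo] --> +oo) -> exists xbar, cluster (x @ \oo) xbar.
Proof.
move=> nx; have [A freqA] : exists A : R, forall K, exists2 k, (K <= k)%N & enorm (x k) <= A.
  apply: contrapT => h; apply: nx; apply/cvgryPge => A.
  apply: contrapT => nA; apply: h; exists A => K.
  apply: contrapT => nk; apply: nA; exists K => // k /= Kk.
  by rewrite leNgt; apply/negP => /ltW kA; apply: nk; exists k.
pose F : set_system nat := within [set k | enorm (x k) <= A] \oo.
have FF : ProperFilter F.
  split; last exact: within_filter.
  by move=> [K _ h]; have [k Kk kA] := freqA K; exact: (h k Kk).
have FK : (x @ F) [set v | enorm (v - 0) <= A].
  by exists 0%N => // k _ kA; rewrite /= subr0.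
have [xbar [_ cl]] := @compact_enorm_ball _ _ 0 A (x @ F) _ FK.
exists xbar => U V xU xV; apply: cl => //.
by case: xU => K _ KU; exists K => // k Kk _; exact: KU.
Qed.

Section Trap.
Variables (x : nat -> 'rV[R]_n) (phi : nat -> R) (xbar : 'rV[R]_n) (r : R) (N : nat).
Hypotheses (r_gt0 : 0 < r) (xbar_cluster : cluster (x @ \oo) xbar).
Hypothesis phi_decr : forall k, (N <= k)%N -> phi k.+1 <= phi k.
Hypothesis phi_ge0 : forall k, (N <= k)%N -> 0 <= phi k.
Hypothesis step_le : forall k, (N <= k)%N -> enorm (x k - xbar) < r ->
  enorm (x k.+1 - x k) <= phi k - phi k.+1.

(* phi need not tend to 0: being nonincreasing and bounded below, it varies by
   arbitrarily little after some index, so it suffices to start from an iterate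
   that is late and close to xbar. *)
Lemma trapped_cvg : forall e, 0 < e ->
  exists2 K, (N <= K)%N & forall k, (K <= k)%N -> enorm (x k - xbar) < e.
Proof.
(* With [e <= r], being within [e] of [xbar] is enough to reuse [step_le]. *)
suff h e : 0 < e -> e <= r ->
    exists2 K, (N <= K)%N & forall k, (K <= k)%N -> enorm (x k - xbar) < e.
  move=> e e0; have m0 : 0 < Num.min e r by rewrite lt_min e0.
  have [|K NK hK] := h _ m0; first by rewrite ge_min lexx orbT.
  by exists K => // k /hK; rewrite lt_min => /andP[].
move=> e0 er; pose S := phi @` [set k | (N <= k)%N].
have infS : has_inf S.
  by split; [exists (phi N), N => /=|exists 0 => _ [k Nk <-]; exact: phi_ge0].
have e20 : 0 < e / 2 by lra.
have [_ [K NK <-] KL] := inf_adherent e20 infS.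
have phiL k : (N <= k)%N -> inf S <= phi k.
  by move=> Nk; apply: ge_inf; [case: infS|exists k].
have phi_mono k j : (N <= k)%N -> phi (k + j)%N <= phi k.
  move=> Nk; elim: j => [|j]; first by rewrite addn0.
  by rewrite addnS; apply: le_trans; apply: phi_decr; exact: leq_trans (leq_addr _ _).
have [k0 Kk0 k0e] := cluster_frequently K xbar_cluster e20.
have Nk0 : (N <= k0)%N := leq_trans NK Kk0.
have phik0 : phi k0 < inf S + e / 2.
  by apply: le_lt_trans KL; rewrite -(subnKC Kk0); exact: phi_mono.
(* The distance travelled from [x k0] is at most [phi k0 - inf S], less than e/2, and [x k0] is
   itself within e/2 of [xbar], so the next step bound is available. *)
have claim j : enorm (x (k0 + j)%N - x k0) <= phi k0 - phi (k0 + j)%N.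
  elim: j => [|j ihj]; first by rewrite addn0 !subrr -(scale0r 0) enormZ normr0 mul0r.
  have Nj : (N <= k0 + j)%N by rewrite (leq_trans Nk0)// leq_addr.
  have xj : enorm (x (k0 + j)%N - xbar) < r.
    have := ler_enorm_distD (x k0) (x (k0 + j)%N) xbar; have := phiL _ Nj; lra.
  have := step_le Nj xj; rewrite addnS.
  have := ler_enorm_distD (x (k0 + j)%N) (x (k0 + j).+1) (x k0); lra.
exists k0 => // k k0k; have := claim (k - k0)%N; rewrite subnKC//.
have := ler_enorm_distD (x k0) (x k) xbar; have := phiL _ (leq_trans Nk0 k0k); lra.
Qed.

(** Telescoping from [k] to a later [m] costs at most [phi k - phi m], hence at most [phi k], and
    [x m] can be taken as close to [xbar] as desired. *)
Lemma trapped_dist : exists2 K, (N <= K)%N &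
  forall k, (K <= k)%N -> enorm (x k - xbar) <= phi k.
Proof.
have [K NK Kr] := trapped_cvg r_gt0; exists K => // k Kk.
have claim j : enorm (x (k + j)%N - x k) <= phi k - phi (k + j)%N.
  elim: j => [|j ihj]; first by rewrite addn0 !subrr -(scale0r 0) enormZ normr0 mul0r.
  have Kj : (K <= k + j)%N by rewrite (leq_trans Kk)// leq_addr.
  have := step_le (leq_trans NK Kj) (Kr _ Kj); rewrite addnS.
  have := ler_enorm_distD (x (k + j)%N) (x (k + j).+1) (x k); lra.
apply/ler_addgt0Pr => e e0; have [m km me] := cluster_frequently k xbar_cluster e0.
have := claim (m - k)%N; rewrite subnKC//.
have := ler_enorm_distD (x m) (x k) xbar; rewrite (enorm_distC (x k) (x m)).
have := phi_ge0 (leq_trans NK (leq_trans Kk km)); lra.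
Qed.

End Trap.
End TrappedSequences.

(** * Descent sequences and the effect of a KL inequality *)

Section Descent.
Context {R : realType} {n : nat}.
Variables (f : 'rV[R]_n -> R) (x : nat -> 'rV[R]_n) (xbar : 'rV[R]_n) (a b : R).
Hypotheses (f_cont : continuous f) (a_gt0 : 0 < a) (b_gt0 : 0 < b).
Hypothesis descent : forall k, (0 < k)%N ->
  f (x k.+1) + a * enorm (x k.+1 - x k) ^+ 2 <= f (x k).
Hypothesis step_gt0 : forall k, (0 < k)%N -> 0 < enorm (x k.+1 - x k).
Hypothesis grad_le : forall k, (0 < k)%N ->
  enorm (grad f (x k)) <= b * enorm (x k.+1 - x k).
Hypothesis xbar_cluster : cluster (x @ \oo) xbar.

Lemma descent_lt k : (0 < k)%N -> f (x k.+1) < f (x k).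
Proof.
move=> k0; apply: lt_le_trans (descent k0).
by rewrite ltrDl mulr_gt0// exprn_gt0// step_gt0.
Qed.

Lemma descent_le j k : (0 < j)%N -> (j <= k)%N -> f (x k) <= f (x j).
Proof.
move=> j0 /subnKC <-; elim: (k - j)%N => [|i]; first by rewrite addn0.
by rewrite addnS; apply: le_trans; apply/ltW/descent_lt; rewrite addn_gt0 j0.
Qed.

(** Were some [f (x j)] below [f xbar], continuity would keep values above [f (x j)] near [xbar],
    whereas late iterates there have smaller values. One more strict descent step gives
    strictness. *)
Lemma cluster_value_lt k : (0 < k)%N -> f xbar < f (x k).
Proof.
suff h j : (0 < j)%N -> f xbar <= f (x j).
  by move=> k0; apply: le_lt_trans (h _ (ltn0Sn k)) (descent_lt k0).
move=> j0; rewrite leNgt; apply/negP => fj.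
have Uj : nbhs xbar (f @^-1` [set s | f (x j) < s]).
  by apply: f_cont; apply: open_nbhs_nbhs; split; [exact: open_gt|].
have [e e0 eU] := nbhs_enormP Uj.
have [m jm /eU/=] := cluster_frequently j xbar_cluster e0.
by rewrite ltNge descent_le.
Qed.

Lemma values_to_cluster e : 0 < e -> exists2 K, (0 < K)%N &
  forall k, (K <= k)%N -> f (x k) < f xbar + e.
Proof.
move=> e0; have Ue : nbhs xbar (f @^-1` [set s | s < f xbar + e]).
  by apply: f_cont; apply: open_nbhs_nbhs; split; [exact: open_lt|rewrite /=; lra].
have [r r0 rU] := nbhs_enormP Ue.
have [K K0 /rU/= fK] := cluster_frequently 1 xbar_cluster r0.
by exists K => // k Kk; apply: le_lt_trans (descent_le K0 Kk) fK.
Qed.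

(** All values exceed [f xbar] and are eventually within a e^2 of it, so no later descent can reach
    a e^2. *)
Lemma steps_to0 e : 0 < e -> exists2 K, (0 < K)%N &
  forall k, (K <= k)%N -> enorm (x k.+1 - x k) < e.
Proof.
move=> e0; have ae0 : 0 < a * e ^+ 2 by rewrite mulr_gt0// exprn_gt0.
have [K K0 hK] := values_to_cluster ae0; exists K => // k Kk.
have k0 := leq_trans K0 Kk.
rewrite -(@ltr_pXn2r _ 2)// ?nnegrE ?enorm_ge0 ?(ltW e0)// -(ltr_pM2l a_gt0).
have := hK k Kk; have := descent k0; have := cluster_value_lt (ltn0Sn k); lra.
Qed.

Section KLDescent.
Variables (eta : R) (U : set 'rV[R]_n) (psi Phi : R -> R).
Hypotheses (eta_gt0 : 0 < eta) (nbhsU : nbhs xbar U).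
Hypothesis psi_gt0 : forall t, 0 < t < eta -> 0 < psi t.
Hypothesis KL_ineq : forall z, U z -> f xbar < f z < f xbar + eta ->
  enorm (grad f z) >= psi (f z - f xbar).
Hypothesis Phi_ge0 : forall t, 0 < t < eta -> 0 <= Phi t.
(** An integrated form of Phi' = 1/psi for nondecreasing [psi]; it fits both a Lebesgue integral and
    an explicit power. *)
Hypothesis Phi_diff : forall s t, 0 < s -> s <= t -> t < eta ->
  (t - s) / psi t <= Phi t - Phi s.

Let Delta k := f (x k) - f xbar.

Lemma KL_descent : [/\
  forall e, 0 < e -> exists2 K, (0 < K)%N & forall k, (K <= k)%N -> enorm (x k - xbar) < e,
  exists2 K, (0 < K)%N & forall k, (K <= k)%N -> enorm (x k - xbar) <= b / a * Phi (Delta k)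
  & exists2 K, (0 < K)%N & forall k, (K <= k)%N ->
      Delta k.+1 + a / b ^+ 2 * psi (Delta k) ^+ 2 <= Delta k].
Proof.
have [N N0 hN] := values_to_cluster eta_gt0.
have [r r0 rU] := nbhs_enormP nbhsU.
have Deltain k : (N <= k)%N -> 0 < Delta k < eta.
  move=> Nk; have := hN _ Nk; have := cluster_value_lt (leq_trans N0 Nk).
  by rewrite /Delta; lra.
have Deltadecr k : (N <= k)%N -> Delta k.+1 <= Delta k.
  by move=> Nk; rewrite lerB// ltW// descent_lt// (leq_trans N0).
have psi_step k : (N <= k)%N -> enorm (x k - xbar) < r ->
    psi (Delta k) <= b * enorm (x k.+1 - x k).
  move=> Nk kr; apply: le_trans (grad_le (leq_trans N0 Nk)).
  apply: KL_ineq; [exact: rU|].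
  by have := Deltain _ Nk; rewrite /Delta; lra.
have Phi_step k : (N <= k)%N ->
    (Delta k - Delta k.+1) / psi (Delta k) <= Phi (Delta k) - Phi (Delta k.+1).
  move=> Nk; case/andP: (Deltain _ Nk) => _ h1.
  by case/andP: (Deltain _ (leqW Nk)) => h2 _; apply: Phi_diff => //; exact: Deltadecr.
have ba0 : 0 < b / a by rewrite divr_gt0.
pose phi k := b / a * Phi (Delta k).
have phi_decr k : (N <= k)%N -> phi k.+1 <= phi k.
  move=> Nk; rewrite /phi ler_pM2l// -subr_ge0; apply: le_trans (Phi_step _ Nk).
  by rewrite divr_ge0 ?subr_ge0 ?Deltadecr// ltW// psi_gt0// Deltain.
have phi_ge0 k : (N <= k)%N -> 0 <= phi k.
  by move=> Nk; rewrite mulr_ge0 ?Phi_ge0 ?Deltain// ltW.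
(* With s the step length, a s psi(Delta k) <= a b s^2 <= b (Delta k - Delta k.+1); divide by a
   psi(Delta k) and apply [Phi_step]. *)
have step_le k : (N <= k)%N -> enorm (x k - xbar) < r ->
    enorm (x k.+1 - x k) <= phi k - phi k.+1.
  move=> Nk kr; rewrite /phi -mulrBr.
  have k0 := leq_trans N0 Nk.
  have psi0 := psi_gt0 (Deltain _ Nk).
  apply: le_trans (ler_wpM2l (ltW ba0) (Phi_step _ Nk)).
  rewrite mulrA ler_pdivlMr// -(ler_pM2l a_gt0).
  have -> : a * (b / a * (Delta k - Delta k.+1)) = b * (f (x k) - f (x k.+1)).
    by rewrite /Delta; field; rewrite gt_eqF.
  have h1 := psi_step _ Nk kr; have h2 := descent k0.
  have h3 := ler_wpM2l (ltW (mulr_gt0 a_gt0 (step_gt0 k0))) h1.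
  have h4 : a * enorm (x k.+1 - x k) ^+ 2 <= f (x k) - f (x k.+1) by lra.
  have := ler_wpM2l (ltW b_gt0) h4; lra.
split.
- move=> e /(trapped_cvg r0 xbar_cluster phi_decr phi_ge0 step_le)[K NK hK].
  by exists K => //; exact: leq_trans NK.
- have [K NK hK] := trapped_dist r0 xbar_cluster phi_decr phi_ge0 step_le.
  by exists K => //; exact: leq_trans NK.
- have [K NK hK] := trapped_cvg r0 xbar_cluster phi_decr phi_ge0 step_le r0.
  exists K => [|k Kk]; first exact: leq_trans NK.
  have Nk := leq_trans NK Kk; have k0 := leq_trans N0 Nk.
  have psi0 := psi_gt0 (Deltain _ Nk).
  have h1 := psi_step _ Nk (hK _ Kk); have h2 := descent k0.
  (* The squared KL bound replaces the step length in the descent inequality by a function of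
     [Delta k] alone. *)
  have h3 : psi (Delta k) ^+ 2 <= (b * enorm (x k.+1 - x k)) ^+ 2.
    by rewrite ler_pXn2r ?nnegrE// ?mulr_ge0 ?enorm_ge0// ltW.
  have b20 : 0 < b ^+ 2 by rewrite exprn_gt0.
  have h4 : a / b ^+ 2 * psi (Delta k) ^+ 2 <= a * enorm (x k.+1 - x k) ^+ 2.
    rewrite -mulrA ler_pM2l// mulrC ler_pdivrMr//.
    by rewrite mulrC -exprMn.
  by rewrite /Delta in h4 *; lra.
Qed.

End KLDescent.
End Descent.

(** * Tangent inequalities for real powers *)

Section PowerTangents.
Context {R : realType}.
Implicit Types p s t u : R.

Lemma powR_expR u p : 0 < u -> u `^ p = expR (p * ln u).
Proof. by move=> u0; rewrite /powR gt_eqF. Qed.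

Lemma powR_ratio p s t : 0 < s -> 0 < t -> s `^ p = t `^ p * (s / t) `^ p.
Proof.
move=> s0 t0; rewrite -powRM ?divr_ge0 ?ltW//.
by rewrite mulrCA divff ?mulr1// gt_eqF.
Qed.

Lemma powR_pred p t : 0 < t -> t `^ p = t * t `^ (p - 1).
Proof.
by move=> t0; rewrite -{2}(powRr1 (ltW t0)) -powRD ?(gt_eqF t0) ?implybT// addrC subrK.
Qed.

(** Homogeneity reduces to u = s / t; then u^p = exp(p ln u) >= 1 + p ln u >= 1 + p (u - 1), the
    last because p <= 0 and ln u <= u - 1. *)
Lemma powR_tangent_convex p s t : p <= 0 -> 0 < s -> 0 < t ->
  t `^ p + p * t `^ (p - 1) * (s - t) <= s `^ p.
Proof.
move=> p0 s0 t0; have u0 : 0 < s / t by rewrite divr_gt0.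
rewrite (powR_ratio p s0 t0) (powR_pred p t0).
have T0 : 0 < t `^ (p - 1) by rewrite powR_gt0.
have h1 : 1 + p * (s / t - 1) <= (s / t) `^ p.
  rewrite powR_expR//; apply: le_trans (expR_ge1Dx _); rewrite lerD2l.
  by apply: ler_wnM2l => //; have := expR_ge1Dx (ln (s / t)); rewrite lnK ?posrE//; lra.
apply: le_trans (ler_wpM2l (ltW (mulr_gt0 t0 T0)) h1).
by rewrite le_eqVlt; apply/orP; left; apply/eqP; field; rewrite gt_eqF.
Qed.

Lemma powR_tangent_concave p s t : 0 <= p <= 1 -> 0 < s -> 0 < t ->
  s `^ p <= t `^ p + p * t `^ (p - 1) * (s - t).
Proof.
move=> /andP[p0 p1] s0 t0; have u0 : 0 < s / t by rewrite divr_gt0.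
rewrite (powR_ratio p s0 t0) (powR_pred p t0).
have T0 : 0 < t `^ (p - 1) by rewrite powR_gt0.
(* The tangent of exp at p l lies below exp at the points l and 0, which have
   weighted mean p l. *)
have h1 : (s / t) `^ p <= 1 + p * (s / t - 1).
  rewrite powR_expR// -{2}(lnK u0); set l := ln _.
  have E0 : 0 < expR (p * l) := expR_gt0 _.
  have e1 : expR (p * l) * (1 + (l - p * l)) <= expR l.
    by rewrite -[in leRHS](subrK (p * l) l) [in leRHS]addrC expRD ler_pM2l// expR_ge1Dx.
  have e2 : expR (p * l) * (1 - p * l) <= 1.
    by rewrite -[leRHS](expRxMexpNx_1 (p * l)) ler_pM2l// expR_ge1Dx.
  have e3 := ler_wpM2l p0 e1.
  have q0 : 0 <= 1 - p by lra.
  by have e4 := ler_wpM2l q0 e2; lra.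
apply: le_trans (ler_wpM2l (ltW (mulr_gt0 t0 T0)) h1) _.
by rewrite le_eqVlt; apply/orP; left; apply/eqP; field; rewrite gt_eqF.
Qed.

End PowerTangents.

(** * Primitives of 1/psi *)

Section Desingularization.
Context {R : realType}.

(** Integrate 1/psi from 0: since 1/psi is nonincreasing, on []s, t]] it is at least its value at
    [t]. *)
Lemma desingularizing_primitive (psi : R -> R) (eta : R) :
  (forall t, 0 < t < eta -> 0 < psi t) ->
  (forall s t, 0 < s -> s <= t -> t < eta -> psi s <= psi t) ->
  (@lebesgue_measure R).-integrable `]0, eta[ (fun t => ((psi t)^-1)%:E) ->
  exists Phi : R -> R, (forall t, 0 < t < eta -> 0 <= Phi t) /\
    (forall s t, 0 < s -> s <= t -> t < eta -> (t - s) / psi t <= Phi t - Phi s).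
Proof.
move=> psi0 psi_mono int; pose mu := @lebesgue_measure R.
pose Phi (t : R) := \int[mu]_(s in `]0, t]) (psi s)^-1; exists Phi.
have intS (s t : R) : 0 <= s -> t < eta ->
    mu.-integrable `]s, t] (EFin \o (fun t => (psi t)^-1)).
  move=> s0 te; apply: integrableS int => //.
  by move=> z /=; rewrite !in_itv/= => /andP[sz zt]; apply/andP; split; lra.
split=> [t /andP[t0 te]|s t s0 st te].
  apply: Rintegral_ge0 => // z /=; rewrite in_itv/= => /andP[z0 zt].
  by rewrite invr_ge0 ltW// psi0// z0; lra.
rewrite /Phi (Rintegral_itvB (intS 0 t (lexx 0) te)) ?bnd_simp ?(ltW s0)//.
move: st; rewrite le_eqVlt => /predU1P[->|st].
  by rewrite subrr mul0r set_itv_ge ?Rintegral_set0// bnd_simp ltxx.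
have -> : (t - s) / psi t = \int[mu]_(z in `]s, t]) (psi t)^-1.
  rewrite Rintegral_cst//= lebesgue_measure_itv/= lte_fin st -EFinB/=.
  by rewrite mulrC.
apply: le_Rintegral => //.
- apply: measurable_bounded_integrable => //.
    by rewrite /= lebesgue_measure_itv/= lte_fin st -EFinB ltry.
  by exists `|(psi t)^-1|; split => // m + z _ /=; exact: ltW.
- by apply: intS => //; exact: ltW.
- move=> z /=; rewrite in_itv/= => /andP[sz zt].
  have pz : 0 < psi z by apply: psi0; lra.
  by rewrite lef_pV2 ?posrE ?psi0 ?psi_mono//; lra.
Qed.

(** The tangent at [t] of the concave power 1 - q, whose derivative carries the exponent -q;
    division by M (1 - q) normalizes it. *)
Lemma power_desingularizing (M q s t : R) : 0 < M -> 0 < q < 1 -> 0 < s -> 0 < t ->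
  (t - s) / (M * t `^ q) <= t `^ (1 - q) / (M * (1 - q)) - s `^ (1 - q) / (M * (1 - q)).
Proof.
move=> M0 q01 s0 t0.
have := @powR_tangent_concave R (1 - q) s t _ s0 t0.
have -> : 1 - q - 1 = - q by lra.
rewrite powRN => /(_ ltac:(lra)) h.
have Mq0 : 0 < M * (1 - q) by rewrite mulr_gt0//; lra.
rewrite -mulrBl ler_pdivlMr//.
have T0 : 0 < t `^ q by rewrite powR_gt0.
have -> : (t - s) / (M * t `^ q) * (M * (1 - q)) = (1 - q) * (t `^ q)^-1 * (t - s).
  by field; rewrite !gt_eqF.
by lra.
Qed.

End Desingularization.

(** * Decay rates from the recursion on values *)

Section Rates.
Context {R : realType}.
Variables (D : nat -> R) (a q : R) (N : nat).
Hypotheses (a_gt0 : 0 < a) (q01 : 0 < q < 1).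
Hypothesis D_gt0 : forall k, (N <= k)%N -> 0 < D k.
Hypothesis D_decr : forall k, (N <= k)%N -> D k.+1 + a * D k `^ (2 * q) <= D k.

Lemma linear_rate : q <= 1 / 2 -> (forall k, (N <= k)%N -> D k <= 1) ->
  exists C t : R, [/\ 0 < C, 0 < t < 1 &
    forall k, (N <= k)%N -> D k `^ (1 - q) <= C * t ^+ k].
Proof.
(* Since [D k <= 1] and 2q <= 1, [D k] is at most its power 2q, so the recursion contracts by 1 - a;
   the maximum with 1/2 makes the ratio positive whatever [a] is. *)
move=> q2 D1; pose t := Num.max (1 - a) (1 / 2).
have t01 : 0 < t < 1.
  have h0 : 0 < 1 / 2 :> R by lra.
  have h1 : 1 / 2 < 1 :> R by lra.
  by rewrite /t lt_max gt_max h0 h1 orbT ltrBlDr ltrDl a_gt0.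
case/andP: (t01) => t0 t1.
have q10 : 0 <= 1 - q by rewrite subr_ge0 ltW//; case/andP: q01.
have step k : (N <= k)%N -> D k.+1 <= t * D k.
  move=> Nk; have Dk := D_gt0 Nk.
  have : D k <= D k `^ (2 * q).
    rewrite -{1}(powRr1 (ltW Dk)); apply: ger_powR; last by lra.
    by rewrite Dk D1.
  have : 1 - a <= t by rewrite le_max lexx.
  have := D_decr Nk; nra.
have geom j : D (N + j)%N <= D N * t ^+ j.
  elim: j => [|j ihj]; first by rewrite addn0 expr0 mulr1.
  rewrite addnS; apply: le_trans (step _ (leq_addr _ _)) _.
  by rewrite exprS mulrCA ler_pM2l.
have DN := D_gt0 (leqnn N).
have tN0 : 0 < D N / t ^+ N by rewrite divr_gt0// exprn_gt0.
(* Dividing by [t ^+ N] absorbs the shift of index by [N]. *)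
exists ((D N / t ^+ N) `^ (1 - q)), (t `^ (1 - q)); split.
- by rewrite powR_gt0.
- have e1 : 1 `^ (1 - q) = 1 :> R by rewrite powR1.
  by rewrite powR_gt0//= -[ltRHS]e1 gt0_ltr_powR ?nnegrE ?ltW//; lra.
- move=> k Nk; rewrite -powR_mulrn ?powR_ge0// -powRrM (mulrC (1 - q)) powRrM.
  rewrite powR_mulrn ?(ltW t0)// -powRM ?exprn_ge0 ?(ltW t0) ?(ltW tN0)//.
  apply: ge0_ler_powR => //; rewrite ?nnegrE.
  + by rewrite ltW// D_gt0.
  + by rewrite mulr_ge0 ?exprn_ge0// ltW.
  have := geom (k - N)%N; rewrite subnKC// => /le_trans; apply.
  by rewrite -mulrA ler_pM2l// -{2}(subnKC Nk) exprD mulKf// expf_neq0// gt_eqF.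
Qed.

Lemma sublinear_rate : 1 / 2 < q ->
  exists2 C : R, 0 < C & exists2 K, (0 < K)%N &
    forall k, (K <= k)%N ->
      D k `^ (1 - q) <= C * k%:R `^ (- ((1 - q) / (2 * q - 1))).
Proof.
have q10 : 0 <= 1 - q by rewrite subr_ge0 ltW//; case/andP: q01.
move=> q2; pose r := 2 * q - 1; have r0 : 0 < r by rewrite /r; lra.
have Dpos k : (N <= k)%N -> 0 < D k := @D_gt0 k.
(* By convexity D^(-r) grows at least linearly along the recursion. *)
have step k : (N <= k)%N -> D k `^ (- r) + r * a <= D k.+1 `^ (- r).
  move=> Nk; have Dk := D_gt0 Nk; have Dk1 := D_gt0 (leqW Nk).
  have nr0 : - r <= 0 by lra.
  apply: le_trans (powR_tangent_convex nr0 Dk1 Dk); rewrite lerD2l.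
  (* Hence the choice of [r]: the slope of the tangent cancels the power 2q in the recursion,
     leaving a gain of at least r a. *)
  have -> : - r - 1 = - (2 * q) by rewrite /r; lra.
  have P0 : 0 < D k `^ (2 * q) by rewrite powR_gt0.
  rewrite powRN; have h := D_decr Nk.
  have -> : - r * (D k `^ (2 * q))^-1 * (D k.+1 - D k) =
      r * ((D k - D k.+1) / D k `^ (2 * q)) by ring.
  by rewrite ler_pM2l// ler_pdivlMr//; lra.
have lin j : r * a * j%:R <= D (N + j)%N `^ (- r).
  elim: j => [|j ihj]; first by rewrite mulr0 powR_ge0.
  rewrite addnS; apply: le_trans (step _ (leq_addr _ _)).
  by rewrite -natr1 mulrDr mulr1 lerD2r.
have c0 : 0 < r * a / 2 by rewrite divr_gt0 ?mulr_gt0.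
exists ((r * a / 2) `^ (- ((1 - q) / r))); first by rewrite powR_gt0.
(* Beyond 2N one has k - N >= k/2, whence the constant r a / 2; the successor makes [k] positive. *)
exists (2 * N).+1%N => // k Nk.
have NK : (N <= k)%N by apply: leq_trans (ltnW Nk); rewrite leq_pmull.
have k0 : 0 < k%:R :> R by rewrite ltr0n (leq_ltn_trans _ Nk).
have h : r * a / 2 * k%:R <= D k `^ (- r).
  have := lin (k - N)%N; rewrite subnKC//; apply: le_trans.
  rewrite -mulrA ler_pM2l ?mulr_gt0// natrB//.
  have : (2 * N)%:R <= k%:R :> R by rewrite ler_nat ltnW.
  by rewrite natrM; lra.
have Dk := D_gt0 NK.
have -> : D k `^ (1 - q) = (D k `^ (- r)) `^ (- ((1 - q) / r)).
  by rewrite -powRrM; congr (_ `^ _); field; rewrite gt_eqF.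
rewrite -powRM ?(ltW c0) ?(ltW k0)//.
rewrite !(powRN _ ((1 - q) / r)) lef_pV2 ?posrE ?powR_gt0 ?mulr_gt0//.
apply: ge0_ler_powR; rewrite ?nnegrE ?powR_ge0//.
- by rewrite divr_ge0 ?(ltW r0).
- by rewrite mulr_ge0 ?(ltW c0) ?(ltW k0).
Qed.

End Rates.

(** * One inexact proximal step as a descent step on the envelope *)

Section InexactProximalPoint.
Context {R : realType} {n : nat} (g : 'rV[R]_n -> \bar R) (lambda mu : R).
Hypotheses (g_proper : proper_fun g) (g_lsc : lower_semicontinuous g).
Hypotheses (g_convex : convex_efun g) (lambda_gt0 : 0 < lambda) (mu_gt2 : 2 < mu).

Let f := fine \o moreau g lambda.

Section Step.
Variables (x y : 'rV[R]_n) (e : R).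
Hypotheses (y_prox : enorm (y - prox g lambda x) <= lambda * e).
Hypothesis (y_far : lambda * mu * e < enorm (x - y)).

Let mu_gt0 : 0 < mu. Proof. exact: lt_trans mu_gt2. Qed.

Lemma inexact_prox_le : enorm (y - prox g lambda x) <= enorm (y - x) / mu.
Proof.
apply: le_trans y_prox _; rewrite ler_pdivlMr// (enorm_distC y x).
by apply/ltW; apply: le_lt_trans y_far; rewrite mulrAC.
Qed.

(** With s the step length, the first-order term is at most (-1 + 1/mu) s^2 / lambda and the
    quadratic one is s^2 / (2 lambda); the sum is negative because mu > 2. *)
Lemma inexact_prox_descent :
  f y + (2 * lambda)^-1 * (1 - 2 / mu) * enorm (y - x) ^+ 2 <= f x.
Proof.
have := moreau_smooth_upper g_proper g_lsc g_convex lambda_gt0 x y.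
rewrite dotrZl (_ : x - prox g lambda x = - (y - x) + (y - prox g lambda x)); last first.
  by rewrite opprB addrA subrK.
rewrite dotrDl dotrNl -enorm_sqr.
have := dotr_le_enorm (y - prox g lambda x) (y - x).
have := ler_wpM2r (enorm_ge0 (y - x)) inexact_prox_le.
rewrite -/f.
have l0 : 0 < lambda^-1 by rewrite invr_gt0.
have -> : (2 * lambda)^-1 = lambda^-1 / 2 by field; rewrite gt_eqF.
move: (enorm (y - x)) (enorm (y - prox _ _ _)) (dotr _ _) (f x) (f y) => s w v fx fy h1 h2 h3.
have := ler_wpM2l (ltW l0) (le_trans h2 h1); lra.
Qed.

(** lambda times the gradient is x - Prox x, of length at most (1 + 1/mu) s <= 2 s. *)
Lemma inexact_prox_grad : enorm (grad f x) <= 2 / lambda * enorm (y - x).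
Proof.
rewrite grad_moreau// enormZ gtr0_norm ?invr_gt0//.
rewrite (mulrC 2) -mulrA ler_pM2l ?invr_gt0//.
have := ler_enorm_distD y x (prox g lambda x); rewrite (enorm_distC x y).
have := inexact_prox_le.
have : enorm (y - x) / mu <= enorm (y - x).
  by rewrite ler_pdivrMr// ler_peMr ?enorm_ge0// ltW// (lt_trans _ mu_gt2)// ltr1n.
lra.
Qed.

End Step.

(** The Lipschitz bound carries small gradients at nearby points over to [z]; a zero gradient makes
    [z] a fixed point of the proximal mapping. *)
Lemma argmin_of_small_grad (z : 'rV[R]_n) :
  (forall e, 0 < e -> exists2 y, enorm (y - z) < e & enorm (grad f y) < e) ->
  argmin g z.
Proof.
move=> small; apply: (argmin_of_prox_fixed g_proper g_lsc g_convex lambda_gt0).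
have dz : enorm (grad f z) = 0.
  apply/le_anti; rewrite enorm_ge0 andbT; apply/ler_addgt0Pr => e e0; rewrite add0r.
  have l10 : 0 < lambda^-1 + 1 by rewrite addr_gt0// invr_gt0.
  have [y yz dy] := small _ (divr_gt0 e0 l10).
  have -> : e = lambda^-1 * (e / (lambda^-1 + 1)) + e / (lambda^-1 + 1).
    by rewrite -{2}[e / _]mul1r -mulrDl mulrC divfK// gt_eqF.
  rewrite -[leLHS](congr1 enorm (subrK (grad f y) _)).
  apply: le_trans (ler_enormD _ _) (lerD _ (ltW dy)).
  apply: (@le_trans _ _ (lambda^-1 * enorm (y - z))); last first.
    by rewrite ler_pM2l ?invr_gt0// ltW.
  rewrite mulrC ler_pdivlMr// mulrC (enorm_distC y) !grad_moreau//.
  exact: moreau_gradient_lipschitz.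
move: dz; rewrite grad_moreau// => /enorm_eq0/eqP.
by rewrite scaler_eq0 invr_eq0 gt_eqF//= subr_eq0 => /eqP.
Qed.

End InexactProximalPoint.

(** * Convergence criteria and proof of the alternative *)

Lemma cvg_of_enorm {R : realType} {n : nat} (x : nat -> 'rV[R]_n) (xbar : 'rV[R]_n) :
  (forall e, 0 < e -> exists2 K, (0 < K)%N & forall k, (K <= k)%N -> enorm (x k - xbar) < e) ->
  x k @[k --> \oo] --> xbar.
Proof.
move=> h U /nbhs_enormP[e e0 eU]; have [K _ hK] := h e e0.
by exists K => // k /hK /eU.
Qed.

(** The shift matches Step 1, where the length of step k controls [eps k.+1]. *)
Lemma cvg0_of_shift {R : realType} (u : nat -> R) :
  (forall e, 0 < e -> exists2 K, (0 < K)%N & forall k, (K <= k)%N -> `|u k.+1| < e) ->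
  u k @[k --> \oo] --> (0 : R).
Proof.
move=> h U /nbhs_ballP[e /= e0 eU]; have [K _ hK] := h e e0.
exists K.+1 => // -[//|k] Kk; apply: eU; rewrite /ball/= sub0r normrN; exact: hK.
Qed.

Theorem theorem4p3 (R : realType) (n : nat) (g : 'rV[R]_n -> \bar R)
    (lambda mu theta : R) (x p : nat -> 'rV[R]_n) (eps : nat -> R)
    (g_proper : proper_fun g) (g_lsc : lower_semicontinuous g)
    (g_convex : convex_efun g)
    (lambda_gt0 : 0 < lambda) (mu_gt2 : 2 < mu) (theta01 : 0 < theta < 1)
    (eps1_gt0 : 0 < eps 1%N)
    (hgippm : gippm g lambda mu theta x p eps)
    (hsub : forall k : nat, (0 < k)%N -> ~ subdiff g (x k) 0) :
  enorm (x k) @[k --> \oo] --> +oo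
  \/
  [/\ (* (i) *)
      [/\ forall xbar : 'rV[R]_n, cluster (x @ \oo) xbar -> argmin g xbar,
          enorm (x k - p k) @[k --> \oo] --> (0 : R)
        & eps k @[k --> \oo] --> (0 : R)],
      (* (ii) *)
      forall xbar : 'rV[R]_n, cluster (x @ \oo) xbar ->
        KL (fine \o moreau g lambda) xbar ->
        x k @[k --> \oo] --> xbar
    & (* (iii) *)
      forall (xbar : 'rV[R]_n) (M q : R), cluster (x @ \oo) xbar ->
        0 < M -> 0 < q < 1 ->
        KL_with (fine \o moreau g lambda) xbar (fun t => M * t `^ q) ->
        (q <= 1 / 2 -> cvg_linearly x xbar) /\
        (1 / 2 < q ->
          (fun k : nat => enorm (x k - xbar) : R^o) =O_\oo
          (fun k : nat => (k%:R `^ (- ((1 - q) / (2 * q - 1)))) : R^o))].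
Proof.
have [x_infty|/cluster_of_not_cvgry[x0 x0_cluster]] :=
  pselect (enorm (x k) @[k --> \oo] --> +oo); first by left.
right; set f := fine \o moreau g lambda.
have mu_gt0 : 0 < mu by apply: lt_trans mu_gt2.
have lmu_gt0 : 0 < lambda * mu by rewrite mulr_gt0.
have eps_gt0 k : (0 < k)%N -> 0 < eps k.
  case: k => // k _; elim: k => // k epsk.
  have [i [_ _ ->]] := hgippm k.+1 isT.
  by rewrite mulr_gt0// exprn_gt0//; case/andP: theta01.
(* The error level at which Step 1 stops is [eps k.+1], so both tests can be stated with it. *)
have stepP k : (0 < k)%N -> [/\ x k.+1 = p k,
    enorm (x k.+1 - prox g lambda (x k)) <= lambda * eps k.+1 &
    lambda * mu * eps k.+1 < enorm (x k - x k.+1)].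
  move=> k0; have [i [[trial [near_prox _ far ->]] -> ->]] := hgippm k k0.
  by split=> //; rewrite mulrA; [exact: near_prox|].
have step_gt0 k : (0 < k)%N -> 0 < enorm (x k.+1 - x k).
  move=> k0; have [_ _] := stepP k k0; rewrite enorm_distC; apply: lt_trans.
  by rewrite mulr_gt0// eps_gt0.
pose a := (2 * lambda)^-1 * (1 - 2 / mu); pose b := 2 / lambda.
have a_gt0 : 0 < a.
  by rewrite mulr_gt0 ?invr_gt0 ?mulr_gt0// subr_gt0 ltr_pdivrMr// mul1r.
have b_gt0 : 0 < b by rewrite divr_gt0.
have descent k : (0 < k)%N -> f (x k.+1) + a * enorm (x k.+1 - x k) ^+ 2 <= f (x k).
  by case/stepP => _ h1 h2; exact: inexact_prox_descent h1 h2.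
have grad_le k : (0 < k)%N -> enorm (grad f (x k)) <= b * enorm (x k.+1 - x k).
  by case/stepP => _ h1 h2; exact: inexact_prox_grad h1 h2.
have f_cont : continuous f := continuous_moreau g_proper g_lsc g_convex lambda_gt0.
(* Step lengths do not depend on the cluster point, so this one serves for all of (i). *)
have steps0 := steps_to0 f_cont a_gt0 descent step_gt0 x0_cluster.
split.
- split.
  + move=> xbar xbar_cluster.
    apply: (argmin_of_small_grad g_proper g_lsc g_convex lambda_gt0) => e e0.
    have [K K0 hK] := steps0 _ (divr_gt0 e0 b_gt0).
    have [k Kk ke] := cluster_frequently K xbar_cluster e0; exists (x k) => //.
    apply: le_lt_trans (grad_le _ (leq_trans K0 Kk)) _.
    by rewrite mulrC -ltr_pdivlMr// hK.
  + apply: cvg0_of_shift => e /steps0[K K0 hK]; exists K => // k Kk.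
    have [<- _ _] := stepP k.+1 isT.
    by rewrite ger0_norm ?enorm_ge0// enorm_distC hK// ltnW.
  + apply: cvg0_of_shift => e e0; have [K K0 hK] := steps0 _ (mulr_gt0 lmu_gt0 e0).
    exists K => // k Kk; have k0 := leq_trans K0 Kk.
    rewrite gtr0_norm ?eps_gt0// -(ltr_pM2l lmu_gt0).
    have [_ _ /lt_trans] := stepP k k0; apply.
    by rewrite enorm_distC hK.
- move=> xbar xbar_cluster [psi [eta [U [[eta0 xU] psi0 psi_mono int KLi]]]].
  have [Phi [Phi0 PhiD]] := desingularizing_primitive psi0 psi_mono int.
  have [h _ _] := KL_descent f_cont a_gt0 b_gt0 descent step_gt0 grad_le xbar_cluster
    eta0 xU psi0 KLi Phi0 PhiD.
  exact: cvg_of_enorm.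
move=> xbar M q xbar_cluster M0 q01 [eta [U [[eta0 xU] psi0 psi_mono _ KLi]]].
have q1 : 0 < 1 - q by rewrite subr_gt0; case/andP: q01.
(* The rates need the primitive of 1/psi as an explicit power. *)
pose Phi t := t `^ (1 - q) / (M * (1 - q)).
have Phi0 t : 0 < t < eta -> 0 <= Phi t.
  by move=> _; rewrite divr_ge0 ?powR_ge0// ltW// mulr_gt0.
have PhiD s t : 0 < s -> s <= t -> t < eta -> (t - s) / (M * t `^ q) <= Phi t - Phi s.
  by move=> s0 st _; apply: power_desingularizing => //; exact: lt_le_trans st.
have [_ [K1 K10 h1] [K2 K20 h2]] := KL_descent f_cont a_gt0 b_gt0 descent step_gt0
  grad_le xbar_cluster eta0 xU psi0 KLi Phi0 PhiD.
(* Closeness 1 gives [D k <= 1], as the linear rate requires. *)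
have [K3 K30 h3] := values_to_cluster f_cont a_gt0 descent step_gt0 xbar_cluster ltr01.
pose N := maxn K1 (maxn K2 K3); pose D k := f (x k) - f xbar.
have NK k : (N <= k)%N -> [/\ (K1 <= k)%N, (K2 <= k)%N & (K3 <= k)%N].
  by rewrite !geq_max => /andP[-> /andP[-> ->]].
have D_gt0 k : (N <= k)%N -> 0 < D k.
  move=> /NK[Kk _ _]; rewrite subr_gt0.
  exact: (cluster_value_lt f_cont a_gt0 descent step_gt0 xbar_cluster (leq_trans K10 Kk)).
(* The factor M^2 comes from squaring psi(t) = M t^q. *)
pose a' := a / b ^+ 2 * M ^+ 2.
have a'_gt0 : 0 < a' by rewrite mulr_gt0 ?divr_gt0 ?exprn_gt0.
have D_decr k : (N <= k)%N -> D k.+1 + a' * D k `^ (2 * q) <= D k.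
  move=> Nk; have [_ Kk _] := NK k Nk; apply: le_trans (h2 k Kk).
  by rewrite (exprMn 2 M) -(powR_mulrn 2 (powR_ge0 _ _)) -powRrM (mulrC q) mulrA.
pose c := b / a / (M * (1 - q)).
have c0 : 0 < c by apply: divr_gt0; [exact: divr_gt0|exact: mulr_gt0].
have dist_le k : (N <= k)%N -> enorm (x k - xbar) <= c * D k `^ (1 - q).
  by move=> /NK[Kk _ _]; apply: le_trans (h1 k Kk) _; rewrite /Phi mulrA mulrAC.
split=> q2.
- have D1 k : (N <= k)%N -> D k <= 1.
    by move=> /NK[_ _ Kk]; have := h3 k Kk; rewrite /D; lra.
  have [C [t [C0 t01 Ct]]] := linear_rate a'_gt0 q01 D_gt0 D_decr q2 D1.
  exists (c * C), t; split=> //; first exact: mulr_gt0.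
  exists N => // k Nk; apply: le_trans (dist_le k Nk) _.
  by rewrite -(mulrA c) ler_pM2l// Ct.
- have [C C0 [K K0 hK]] := sublinear_rate a'_gt0 q01 D_gt0 D_decr q2.
  apply/eqO_exP; exists (c * C); first exact: mulr_gt0.
  exists (maxn N K) => // k /=; rewrite geq_max => /andP[Nk Kk].
  rewrite !ger0_norm ?enorm_ge0 ?powR_ge0//.
  by apply: le_trans (dist_le k Nk) _; rewrite -(mulrA c) ler_pM2l// hK.
Qed.
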